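(* There exists a square root $G\in\mathcal{S}$ of Thompson's group $F$ which admits no finite presentation.
   Context: Let $I=[0,1]$ and let $\mathrm{Homeo}^+(I)$ be the group of orientation-preserving homeomorphisms of $I$. For a homeomorphism $f$, $\operatorname{supp} f=\{x : f(x)\neq x\}$. Two nonempty open intervals $J_1,J_2$ form a two-chain if $J_1\cap J_2$ is a nonempty proper subinterval of $J_1$ and of $J_2$. Thompson's group is $F\cong\langle A,B\mid [A,(AB)^{-1}B(AB)],\ [A,(AB)^{-2}B(AB)^2]\rangle$. A square root of $F$ is a two-generated subgroup $\langle f,g\rangle<\mathrm{Homeo}^+(I)$ such that $\langle f^2,g^2\rangle\cong F$ and such that $\operatorname{supp} f$ and $\operatorname{supp} g$ are open intervals forming a two-chain. $\mathcal{S}$ denotes the set of isomorphism classes of square roots of $F$; $G\in\mathcal S$ means that $G$ is a square root of $F$. *)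

(* Defs.v *)
From HB Require Import structures.
From mathcomp Require Import all_boot all_order all_algebra generic_quotient.
From mathcomp Require Import all_classical all_reals all_analysis.

Set Implicit Arguments.
Unset Strict Implicit.
Unset Printing Implicit Defensive.

Import Order.TTheory GRing.Theory Num.Theory.
Import numFieldNormedType.Exports.

Local Open Scope classical_set_scope.
Local Open Scope quotient_scope.

Definition isomorphic (G H : groupType) : Prop :=
  exists f : {multiplicative G -> H}, bijective f.

(* The letter [(i, false)] stands for the i-th generator and [(i, true)] for
   its inverse. *)
Definition word (n : nat) : Type := seq ('I_n * bool).

Definition inv_letter (n : nat) (l : 'I_n * bool) : 'I_n * bool :=
  (l.1, ~~ l.2).

Definition inv_word (n : nat) (w : word n) : word n :=
  rev (map (@inv_letter n) w).

(* Two words are related when they represent the same element of the quotient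
   of the free group on ['I_n] by the normal closure of [rels]. *)
Inductive word_equiv (n : nat) (rels : seq (word n)) :
    word n -> word n -> Prop :=
| WordRefl u : word_equiv rels u u
| WordSym u v : word_equiv rels u v -> word_equiv rels v u
| WordTrans u v w :
    word_equiv rels u v -> word_equiv rels v w -> word_equiv rels u w
| WordCancel u v l : word_equiv rels (u ++ [:: l; inv_letter l] ++ v) (u ++ v)
| WordRel u v r : r \in rels -> word_equiv rels (u ++ r ++ v) (u ++ v).

Section Presented.
Variables (n : nat) (rels : seq (word n)).

Definition word_equivb (u v : word n) : bool := `[< word_equiv rels u v >].

Lemma word_equivb_refl : reflexive word_equivb.
Proof. by move=> u; apply/asboolP; exact: WordRefl. Qed.

Lemma word_equivb_sym : symmetric word_equivb.
Proof. by move=> u v; apply/asboolP/asboolP; exact: WordSym. Qed.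

Lemma word_equivb_trans : transitive word_equivb.
Proof.
by move=> v u w /asboolP uv /asboolP vw; apply/asboolP; exact: WordTrans uv vw.
Qed.

Canonical word_equivb_equiv :=
  EquivRel word_equivb word_equivb_refl word_equivb_sym word_equivb_trans.

Definition presented := {eq_quot word_equivb}.

HB.instance Definition _ := Choice.on presented.
HB.instance Definition _ : EqQuotient _ word_equivb presented :=
  EqQuotient.on presented.

Lemma presentedP (u v : word n) :
  \pi_presented u = \pi_presented v <-> word_equiv rels u v.
Proof. by split=> [/eqmodP/asboolP|?]; last by apply/eqmodP/asboolP. Qed.

Lemma word_equiv_cat2l (u v w : word n) :
  word_equiv rels v w -> word_equiv rels (u ++ v) (u ++ w).
Proof.
elim=> {v w} [v|v w _ ?|v w x _ vw _ wx|v w l|v w r rr].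
- exact: WordRefl.
- exact: WordSym.
- exact: WordTrans vw wx.
- by rewrite !(catA u); exact: WordCancel.
- by rewrite !(catA u); exact: WordRel.
Qed.

Lemma word_equiv_cat2r (u v w : word n) :
  word_equiv rels v w -> word_equiv rels (v ++ u) (w ++ u).
Proof.
elim=> {v w} [v|v w _ ?|v w x _ vw _ wx|v w l|v w r rr].
- exact: WordRefl.
- exact: WordSym.
- exact: WordTrans vw wx.
- by rewrite -!catA; exact: WordCancel.
- by rewrite -!catA; exact: WordRel.
Qed.

Lemma word_equiv_cat (u u' v v' : word n) :
  word_equiv rels u u' -> word_equiv rels v v' ->
  word_equiv rels (u ++ v) (u' ++ v').
Proof.
move=> uu' vv'.
exact: WordTrans (word_equiv_cat2r v uu') (word_equiv_cat2l u' vv').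
Qed.

Lemma inv_letterK : involutive (@inv_letter n).
Proof. by case=> i b; rewrite /inv_letter negbK. Qed.

Lemma inv_wordK : involutive (@inv_word n).
Proof.
by move=> w; rewrite /inv_word map_rev revK mapK//; exact: inv_letterK.
Qed.

Lemma inv_word_cat (u v : word n) :
  inv_word (u ++ v) = inv_word v ++ inv_word u.
Proof. by rewrite /inv_word map_cat rev_cat. Qed.

Lemma word_equiv_catV (u : word n) : word_equiv rels (u ++ inv_word u) [::].
Proof.
elim: u => [|l u IHu]; first exact: WordRefl.
have -> : (l :: u) ++ inv_word (l :: u) =
    [:: l] ++ (u ++ inv_word u) ++ [:: inv_letter l].
  by rewrite /inv_word /= rev_cons -cats1 -catA.
apply: (@WordTrans _ _ _ ([:: l] ++ [::] ++ [:: inv_letter l])).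
  exact/word_equiv_cat2l/word_equiv_cat2r.
exact: (WordCancel rels [::] [::] l).
Qed.

Lemma word_equiv_catVl (u : word n) : word_equiv rels (inv_word u ++ u) [::].
Proof. by rewrite -{2}(inv_wordK u); exact: word_equiv_catV. Qed.

Lemma word_equiv_inv (u v : word n) :
  word_equiv rels u v -> word_equiv rels (inv_word u) (inv_word v).
Proof.
move=> uv.
have H1 := word_equiv_cat2l (inv_word u) (WordSym (word_equiv_catV v)).
rewrite cats0 in H1; apply: (WordTrans H1); rewrite catA.
have H2 := word_equiv_cat2l (inv_word u) (WordSym uv).
exact: (word_equiv_cat2r (inv_word v) (WordTrans H2 (word_equiv_catVl u))).
Qed.

Definition presented_one : presented := \pi_presented ([::] : word n).
Definition presented_mul (x y : presented) : presented :=
  \pi_presented (repr x ++ repr y : word n).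
Definition presented_inv (x : presented) : presented :=
  \pi_presented (inv_word (repr x)).

Lemma repr_presented (u : word n) :
  word_equiv rels (repr (\pi_presented u)) u.
Proof. by apply/presentedP; rewrite reprK. Qed.

Lemma presented_mulE (u v : word n) :
  presented_mul (\pi_presented u) (\pi_presented v) = \pi_presented (u ++ v : word n).
Proof. by apply/presentedP/word_equiv_cat; exact: repr_presented. Qed.

Lemma presented_invE (u : word n) :
  presented_inv (\pi_presented u) = \pi_presented (inv_word u).
Proof. exact/presentedP/word_equiv_inv/repr_presented. Qed.

Lemma presented_mulA : associative presented_mul.
Proof.
move=> x y z; apply/presentedP.
apply: (@WordTrans _ _ _ (repr x ++ repr y ++ repr z)).
  exact/word_equiv_cat2l/repr_presented.
rewrite catA; exact/word_equiv_cat2r/WordSym/repr_presented.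
Qed.

Lemma presented_mul1 : left_id presented_one presented_mul.
Proof. by move=> x; rewrite -[x]reprK presented_mulE. Qed.

Lemma presented_1mul : right_id presented_one presented_mul.
Proof. by move=> x; rewrite -[x]reprK presented_mulE cats0. Qed.

Lemma presented_mulV :
  left_inverse presented_one presented_inv presented_mul.
Proof.
move=> x; rewrite -[x]reprK presented_invE presented_mulE.
exact/presentedP/word_equiv_catVl.
Qed.

Lemma presented_Vmul :
  right_inverse presented_one presented_inv presented_mul.
Proof.
move=> x; rewrite -[x]reprK presented_invE presented_mulE.
exact/presentedP/word_equiv_catV.
Qed.

HB.instance Definition _ := isGroup.Build presented
  presented_mulA presented_mul1 presented_1mul presented_mulV presented_Vmul.

End Presented.

Definition finitely_presented (G : groupType) : Prop :=
  exists (n : nat) (rels : seq (word n)), isomorphic G (presented rels).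

(* [u^-1 v^-1 u v]; the other convention for commutators has the same normal
   closure. *)
Definition comm_word (n : nat) (u v : word n) : word n :=
  inv_word u ++ inv_word v ++ u ++ v.

Definition conj_word (n : nat) (u v : word n) : word n :=
  inv_word v ++ u ++ v.

Definition wA : word 2 := [:: (ord0, false)].
Definition wB : word 2 := [:: (ord_max, false)].

Definition thompsonF : groupType :=
  presented [:: comm_word wA (conj_word wB (wA ++ wB));
                comm_word wA (conj_word wB ((wA ++ wB) ++ (wA ++ wB)))].

Section Generated.
Variables (G : groupType).

Definition generated (A : set G) : {pred G} :=
  [pred x | `[< smallest [set H : set G | group_closed (mem H)] A x >]].

Lemma generated_closed (A : set G) : group_closed (generated A).
Proof.
split=> [|x y xA yA].
  by apply: asboolT => H /= [[H1 _] _]; move: H1; rewrite inE.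
apply: asboolT => H /= [[H1 HF] AH].
have := HF x y; rewrite !inE; apply.
  by move/asboolP: xA; apply; split.
by move/asboolP: yA; apply; split.
Qed.

HB.instance Definition _ (A : set G) := isMulClosed.Build G (generated A)
  (group_closedM (generated_closed A)).
HB.instance Definition _ (A : set G) := isMul1Closed.Build G (generated A)
  (generated_closed A).1.
HB.instance Definition _ (A : set G) := isInvClosed.Build G (generated A)
  (group_closedV (generated_closed A)).

End Generated.

Section SubgroupType.
Variables (G : groupType) (S : groupClosed G).

Definition subgroup : Type := {x : G | x \in S}.

HB.instance Definition _ := SubChoice.on subgroup.

Lemma subgroup_closed : group_closed S.
Proof. by split; [exact: gpred1|exact: gpredF]. Qed.

HB.instance Definition _ :=
  SubChoice_isSubGroup.Build G _ subgroup subgroup_closed.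

End SubgroupType.

Section Homeo.
Variable R : realType.

Definition unitI : Type := set_type (`[0%R, 1%R] : set R).

HB.instance Definition _ := Topological.on unitI.
HB.instance Definition _ := Choice.on unitI.

Definition unitI_val (x : unitI) : R := set_val x.

Definition homeomorphism (f : unitI -> unitI) : Prop :=
  continuous f /\
  exists g : unitI -> unitI, [/\ cancel f g, cancel g f & continuous g].

Definition orientation_preserving (f : unitI -> unitI) : Prop :=
  forall x y : unitI,
    (unitI_val x < unitI_val y)%R -> (unitI_val (f x) < unitI_val (f y))%R.

Record homeoI := HomeoI {
  homeoI_fun :> unitI -> unitI;
  _ : `[< homeomorphism homeoI_fun /\ orientation_preserving homeoI_fun >]
}.

HB.instance Definition _ := [isSub for homeoI_fun].
HB.instance Definition _ := [Choice of homeoI by <:].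

Lemma homeoIP (f : homeoI) : homeomorphism f /\ orientation_preserving f.
Proof. by case: f => f /= /asboolP. Qed.

Lemma homeoI_eq (f g : homeoI) : f =1 g -> f = g.
Proof. by move=> fg; apply/val_inj/funext. Qed.

Definition homeoI_inv_fun (f : homeoI) : unitI -> unitI :=
  sval (cid (homeoIP f).1.2).

Lemma homeoI_inv_funP (f : homeoI) :
  [/\ cancel f (homeoI_inv_fun f), cancel (homeoI_inv_fun f) f &
      continuous (homeoI_inv_fun f)].
Proof. exact: (svalP (cid (homeoIP f).1.2)). Qed.

Lemma homeoI_one_subproof :
  `[< homeomorphism (id : unitI -> unitI) /\
      orientation_preserving (id : unitI -> unitI) >].
Proof.
apply/asboolP; split; last by [].
split; first by move=> x; exact: cvg_id.
by exists id; split=> // x; exact: cvg_id.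
Qed.

Lemma homeoI_mul_subproof (f g : homeoI) :
  `[< homeomorphism (f \o g) /\ orientation_preserving (f \o g) >].
Proof.
apply/asboolP; have [[cf _] of_] := homeoIP f; have [[cg _] og] := homeoIP g.
have [fK Kf cf'] := homeoI_inv_funP f; have [gK Kg cg'] := homeoI_inv_funP g.
split; last by move=> x y xy; apply/of_/og.
split; first by move=> x; apply: continuous_comp; [exact: cg|exact: cf].
exists (homeoI_inv_fun g \o homeoI_inv_fun f).
split; [exact: can_comp|exact: can_comp|].
by move=> x; apply: continuous_comp; [exact: cf'|exact: cg'].
Qed.

Lemma homeoI_inv_subproof (f : homeoI) :
  `[< homeomorphism (homeoI_inv_fun f) /\
      orientation_preserving (homeoI_inv_fun f) >].
Proof.
apply/asboolP; have [[cf _] of_] := homeoIP f.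
have [fK Kf cf'] := homeoI_inv_funP f.
split; first by split=> //; exists f.
move=> x y; rewrite -{1}(Kf x) -{1}(Kf y).
set a := homeoI_inv_fun f x; set b := homeoI_inv_fun f y => fab.
rewrite ltNge le_eqVlt; apply/negP => /orP[/eqP /val_inj ba|/of_ fba].
  by move: fab; rewrite ba ltxx.
by have := lt_trans fab fba; rewrite ltxx.
Qed.

Definition homeoI_one : homeoI := HomeoI homeoI_one_subproof.
Definition homeoI_mul (f g : homeoI) : homeoI :=
  HomeoI (homeoI_mul_subproof f g).
Definition homeoI_inv (f : homeoI) : homeoI := HomeoI (homeoI_inv_subproof f).

Lemma homeoI_mulA : associative homeoI_mul.
Proof. by move=> f g h; exact: homeoI_eq. Qed.

Lemma homeoI_mul1 : left_id homeoI_one homeoI_mul.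
Proof. by move=> f; exact: homeoI_eq. Qed.

Lemma homeoI_1mul : right_id homeoI_one homeoI_mul.
Proof. by move=> f; exact: homeoI_eq. Qed.

Lemma homeoI_mulV : left_inverse homeoI_one homeoI_inv homeoI_mul.
Proof.
by move=> f; apply: homeoI_eq => x; have [fK _ _] := homeoI_inv_funP f; exact: fK.
Qed.

Lemma homeoI_Vmul : right_inverse homeoI_one homeoI_inv homeoI_mul.
Proof.
by move=> f; apply: homeoI_eq => x; have [_ Kf _] := homeoI_inv_funP f; exact: Kf.
Qed.

HB.instance Definition _ := isGroup.Build homeoI
  homeoI_mulA homeoI_mul1 homeoI_1mul homeoI_mulV homeoI_Vmul.

Definition supp (f : homeoI) : set unitI := [set x | f x <> x].

(* Endpoints in the unit interval are enough: a support never contains 0 or 1,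
   so the relatively open sets [0, b) and (a, 1] need not be considered. *)
Definition nonempty_open_interval (J : set unitI) : Prop :=
  exists a b : unitI, (unitI_val a < unitI_val b)%R /\
    J = [set x | (unitI_val a < unitI_val x < unitI_val b)%R].

Definition two_chain (J1 J2 : set unitI) : Prop :=
  [/\ nonempty_open_interval J1, nonempty_open_interval J2, nonempty_open_interval (J1 `&` J2),
      J1 `&` J2 `<` J1 & J1 `&` J2 `<` J2].

Definition square_root_F (G : groupClosed homeoI) : Prop :=
  exists f g : homeoI,
    [/\ G =i generated [set f; g],
        isomorphic (subgroup (generated [set (f ^+ 2)%g; (g ^+ 2)%g])) thompsonF
      & two_chain (supp f) (supp g)].

End Homeo.

(* Main.v *)
From HB Require Import structures.
From mathcomp Require Import all_boot all_order all_algebra generic_quotient.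
From mathcomp Require Import zify ring lra.
From mathcomp Require Import all_classical all_reals all_analysis.
Require Import Defs.

(* Two homeomorphisms [A] and [B] whose supports [(a, c)] and [(b, d)] form a
   chain, which move points to the left, and which satisfy [A (B c) <= b]
   generate a copy of Thompson's group: the relations of [thompsonF] hold
   because supports become disjoint, and an element acting trivially is trivial
   because every element is a fraction of two products of [x_i] with
   nondecreasing indices, and such a product is determined by its action near
   the left ends of the supports of the [x_i], which increase with [i].

   For every [t] in [(1/3, 5/12)] there are roots [f] and [g], with supports
   [(0, 2/3)] and [(1/3, 1)], such that [f^2] and [g^2] are as above and such
   that a fixed word in [f] and [g] sends [1/3] to [t], whereas the orbit of
   [2/3] contains a dense subset of [(1/3, 2/3)] that is the same for all [t]
   and is reached by the same words.  Since a conjugate of [f] by [V] commutes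
   with a conjugate of [g] by [W] if and only if [V (2/3) <= W (1/3)], the
   relations between [f] and [g] determine [t].  This gives uncountably many
   2-generated marked groups, but finitely presented groups provide only
   countably many. *)

Set Implicit Arguments.
Unset Strict Implicit.
Unset Printing Implicit Defensive.

Import Order.TTheory GRing.Theory Num.Theory.
Import numFieldNormedType.Exports.
Local Open Scope classical_set_scope.
Local Open Scope quotient_scope.
Local Open Scope group_scope.

(** * Evaluation of words in a group and substitution of words *)

Section WordEvaluation.
Variable n : nat.

Definition eval_letter (G : groupType) (s : 'I_n -> G) (l : 'I_n * bool) : G :=
  if l.2 then (s l.1)^-1 else s l.1.

Definition eval (G : groupType) (s : 'I_n -> G) (w : word n) : G :=
  \prod_(l <- w) eval_letter s l.

Variable G : groupType.
Implicit Types (s : 'I_n -> G) (u v w : word n).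

Lemma eval_nil s : eval s [::] = 1.
Proof. exact: big_nil. Qed.

Lemma eval_cons s l w : eval s (l :: w) = eval_letter s l * eval s w.
Proof. exact: big_cons. Qed.

Lemma eval_cat s u v : eval s (u ++ v) = eval s u * eval s v.
Proof. exact: big_cat. Qed.

Lemma eval_letter_inv s l : eval_letter s (inv_letter l) = (eval_letter s l)^-1.
Proof. by case: l => i [] //=; rewrite /eval_letter /= invgK. Qed.

Lemma eval_inv_word s w : eval s (inv_word w) = (eval s w)^-1.
Proof.
elim: w => [|l w IHw]; first by rewrite /inv_word eval_nil invg1.
rewrite -cat1s inv_word_cat !eval_cat invgM IHw; congr (_ * _).
by rewrite /inv_word /= !eval_cons eval_nil !mulg1 eval_letter_inv.
Qed.

Lemma eval_word_equiv s (rels : seq (word n)) u v :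
  (forall r, r \in rels -> eval s r = 1) ->
  word_equiv rels u v -> eval s u = eval s v.
Proof.
move=> s_rels; elim=> {u v} // [u v w _ -> _ //|u v l|u v r /s_rels r1].
- by rewrite !eval_cat !eval_cons eval_nil mulg1 eval_letter_inv mulgV mul1g.
- by rewrite !eval_cat r1 mul1g.
Qed.

Lemma eq_eval_word s s' : s =1 s' -> eval s =1 eval s'.
Proof. by move=> ss' w; apply: eq_bigr => l _; rewrite /eval_letter ss'. Qed.

End WordEvaluation.

(** Multiplicativity alone suffices as a hypothesis, since it forces [f] to respect [1] and
    inverses. *)
Lemma morph_eval (n : nat) (G H : groupType) (f : G -> H) (s : 'I_n -> G) w :
  {morph f : x y / x * y} -> f (eval s w) = eval (f \o s) w.
Proof.
move=> fM.
have f1 : f 1 = 1 by apply: (mulgI (f 1)); rewrite -fM !mulg1.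
have fV x : f x^-1 = (f x)^-1.
  by apply: (mulgI (f x)); rewrite -fM !mulgV.
elim: w => [|[i []] w IHw]; first by rewrite !eval_nil f1.
- by rewrite !eval_cons fM IHw /eval_letter /= fV.
- by rewrite !eval_cons fM IHw.
Qed.

Lemma eval_presented (n m : nat) (rels : seq (word n)) (u : 'I_m -> word n) w :
  eval (fun i => \pi_(presented rels) (u i)) w =
  \pi_(presented rels)
    (flatten [seq if l.2 then inv_word (u l.1) else u l.1 | l <- w] : word n).
Proof.
elim: w => [|[i b] w IHw]; first by rewrite eval_nil.
rewrite eval_cons IHw.
have -> : eval_letter (fun i => \pi_(presented rels) (u i)) (i, b) =
    \pi_(presented rels) (if b then inv_word (u i) else u i : word n).
  by case: b; rewrite /eval_letter //=; exact: presented_invE.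
exact: presented_mulE.
Qed.

Lemma eval_presented_gen (n : nat) (rels : seq (word n)) (w : word n) :
  eval (fun i => \pi_(presented rels) ([:: (i, false)] : word n)) w =
  \pi_(presented rels) w.
Proof.
rewrite eval_presented; congr (\pi_(presented rels) _).
by elim: w => //= -[i []] w /= ->.
Qed.

(** * Two-generated subgroups and codes for their finite presentations *)

Section TwoGenerated.
Variable G : groupType.
Implicit Types f g x : G.

Definition marking f g (i : 'I_2) : G := if i == ord0 then f else g.

Lemma mem_generated1 (A : set G) x : A x -> x \in generated A.
Proof. by move=> Ax; apply: asboolT => H /= [_]; exact. Qed.

Lemma generatedP f g x :
  (exists w, x = eval (marking f g) w) <-> x \in generated [set f; g].
Proof.
have gen_i i : marking f g i \in generated [set f; g].
  by apply: mem_generated1; rewrite /marking; case: ifP; [left|right].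
split=> [[w ->]|].
  elim: w => [|[i b] w IHw]; first by rewrite eval_nil gpred1.
  by rewrite eval_cons gpredM// /eval_letter /=; case: b; rewrite ?gpredV.
move=> /asboolP/(_ [set x | exists w, x = eval (marking f g) w]); apply.
split=> [|y [->|->] /=].
- split=> [|y z]; first by rewrite inE; exists [::]; rewrite eval_nil.
  rewrite !inE => -[u ->] [v ->]; exists (u ++ inv_word v).
  by rewrite eval_cat eval_inv_word.
- by exists [:: (ord0, false)]; rewrite eval_cons eval_nil mulg1.
- by exists [:: (ord_max, false)]; rewrite eval_cons eval_nil mulg1.
Qed.

(** The isomorphism is the inverse of [h] on its image, obtained by choosing preimages; injectivity
    of [h] makes it multiplicative. *)
Lemma isomorphic_generated f g (H : groupType) (h : {multiplicative H -> G}) :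
  injective h -> (forall x, x \in generated [set f; g] <-> exists y, h y = x) ->
  isomorphic (subgroup (generated [set f; g])) H.
Proof.
move=> h_inj h_im.
have pre (x : subgroup (generated [set f; g])) : exists y, h y = val x.
  by apply/h_im; exact: (valP x).
pose k (z : subgroup (generated [set f; g])) := sval (cid (pre z)).
have kK z : h (k z) = val z by exact: (svalP (cid (pre z))).
have k_mul : {morph k : y z / y * z}.
  by move=> y z; apply: h_inj; rewrite gmulfM !kK valM.
pose kM := isMultiplicative.Build _ _ k k_mul.
pose km : {multiplicative subgroup (generated [set f; g]) -> H} :=
  HB.pack k kM.
exists km.
have im y : h y \in generated [set f; g] by apply/h_im; exists y.
exists (fun y => Sub (h y) (im y)) => [x|y] /=.
  by apply: val_inj; rewrite SubK kK.
by apply: h_inj; rewrite kK SubK.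
Qed.

End TwoGenerated.

(* A finite presentation, and words for the images of the two generators of a
   marked group under an isomorphism with the presented group. *)
Definition presentation_code : Type :=
  {n : nat & (seq (word n) * (word n * word n))%type}.

Definition coded_kernel (c : presentation_code) : set (word 2) :=
  let: existT n (rels, (u, v)) := c in
  [set w | eval (marking (\pi_(presented rels) u) (\pi_(presented rels) v)) w
           = 1].

(** An isomorphism preserves which words are trivial, so the kernel can be read off in the presented
    group from representatives of the images of [f] and [g]. Hence such kernels range over a family
    indexed by finite data. *)
Lemma finitely_presented_code (G : groupType) (f g : G) :
  finitely_presented (subgroup (generated [set f; g])) ->
  exists c, [set w | eval (marking f g) w = 1] = coded_kernel c.
Proof.
move=> [n [rels [h /bij_inj h_inj]]].
have fP : f \in generated [set f; g] by apply: mem_generated1; left.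
have gP : g \in generated [set f; g] by apply: mem_generated1; right.
pose f' : subgroup _ := Sub f fP; pose g' : subgroup _ := Sub g gP.
exists (existT _ n (rels, (repr (h f'), repr (h g')))).
rewrite /coded_kernel !reprK; apply/seteqP.
have val_eval w : val (eval (marking f' g') w) = eval (marking f g) w.
  rewrite (morph_eval _ _ (@valM _ _ _)); apply: eq_eval_word => i /=.
  by rewrite /marking; case: ifP.
have h_eval w : h (eval (marking f' g') w) = eval (marking (h f') (h g')) w.
  rewrite (morph_eval _ _ (@gmulfM _ _ h)); apply: eq_eval_word => i /=.
  by rewrite /marking; case: ifP.
have h1 : h 1 = 1 by apply: (mulgI (h 1)); rewrite -gmulfM !mulg1.
split=> w /=; rewrite -val_eval -h_eval => w1.
  by rewrite -h1; congr (h _); apply: val_inj; rewrite w1 val1.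
by rewrite -h1 in w1; rewrite (h_inj _ _ w1) val1.
Qed.

(** * The infinite presentation of [F] and its normal forms, derived from two relations *)

Section ThompsonGenerators.
Variables (G : groupType) (a b : G).
Hypotheses (ab1 : commute a (b ^ (a * b))) (ab2 : commute a (b ^ (a * b) ^+ 2)).

(* The generators [x_0, x_1, ...] of the infinite presentation of [F]. *)
Definition xgen (n : nat) : G := if n is m.+1 then b ^ (a * b) ^+ m else a * b.

(** The two hypotheses are the cases of [x_2] and [x_3]. Since [x_(m+4)] is the conjugate of
    [x_(m+3)] by [x_(m+2)], an induction carrying two consecutive cases gives all the others. *)
Lemma commute_xgen m : commute a (xgen m.+2).
Proof.
suff: commute a (xgen m.+2) /\ commute a (xgen m.+3) by case.
elim: m => [|m [IH1 IH2]]; split => //.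
set s := a * b in IH1 IH2 *.
have E : (b ^ s) ^ b = b ^ (s ^+ 2).
  rewrite expg2 (conjgM b s s) {3}/s (conjgM _ a b); congr (_ ^ _).
  by apply/esym/conjg_fixP/commgP/commute_sym.
have <- : xgen m.+3 ^ xgen m.+2 = xgen m.+4.
  rewrite /xgen -/s (expgS s m.+1) (conjgM b s) -conjJg E -conjgM.
  by rewrite -expgnDr.
rewrite conjgE; do 2?apply: commuteM => //.
exact: commuteV.
Qed.

Lemma xgenJ k n : (k < n)%N -> xgen n ^ xgen k = xgen n.+1.
Proof.
case: n => // n; case: k => [_|k]; first by rewrite /xgen expgSr (conjgM b).
rewrite ltnS => kn; have [m ->] : exists m, n = (m.+1 + k)%N.
  by exists (n - k.+1)%N; lia.
(* Conjugation by [(a * b) ^+ k] shifts positive indices by [k], which reduces the claim to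
   conjugation by [x_1 = b]. There [b] may be replaced by [a * b], because [a] commutes with
   [x_(m+2)]. *)
have conjD i : xgen (i + k).+1 = xgen i.+1 ^ (a * b) ^+ k.
  by rewrite /xgen expgnDr (conjgM b).
rewrite conjD -(add0n k) conjD add0n -conjJg -addSn conjD; congr (_ ^ _).
have -> : xgen m.+3 = xgen m.+2 ^ (a * b) by rewrite /xgen expgSr (conjgM b).
rewrite conjgM /xgen expg0 conjg1; congr (_ ^ _).
exact/esym/conjg_fixP/commgP/commute_sym/commute_xgen.
Qed.

Definition xprod (l : seq nat) : G := \prod_(i <- l) xgen i.

Lemma xprod_nil : xprod [::] = 1. Proof. exact: big_nil. Qed.

Lemma xprod_cons i l : xprod (i :: l) = xgen i * xprod l.
Proof. exact: big_cons. Qed.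

(* [x_n x_k = x_k x_(n+1)] for [k < n] moves [x_n] to its place. *)
Fixpoint xinsert (n : nat) (l : seq nat) : seq nat :=
  if l is k :: t then if (n <= k)%N then n :: l else k :: xinsert n.+1 t
  else [:: n].

Lemma xprod_insert n l : xprod (xinsert n l) = xgen n * xprod l.
Proof.
elim: l n => [|k t IHt] n /=; first by rewrite xprod_cons.
case: leqP => kn; rewrite !xprod_cons // IHt -(xgenJ kn).
by rewrite mulgA -conjgC mulgA.
Qed.

Lemma all_insert m n l :
  (m <= n)%N -> all (leq m) l -> all (leq m) (xinsert n l).
Proof.
elim: l n => [|k t IHt] n /= mn; first by rewrite mn.
case/andP=> mk mt; case: ifP => _ /=; first by rewrite mn mk.
by rewrite mk IHt // leqW.
Qed.

Lemma sorted_insert n l : sorted leq l -> sorted leq (xinsert n l).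
Proof.
elim: l n => // k t IHt n /= kt.
case: leqP => [nk|kn] /=; first by rewrite nk.
rewrite path_sortedE; last exact: leq_trans.
move: kt; rewrite path_sortedE; last exact: leq_trans.
by case/andP=> kt st; rewrite all_insert ?IHt // leqW // ltnW.
Qed.

Lemma xprod_sorted l : exists2 l', sorted leq l' & xprod l = xprod l'.
Proof.
elim: l => [|n l [l' sl' ll']]; first by exists [::].
exists (xinsert n l'); first exact: sorted_insert.
by rewrite xprod_insert xprod_cons ll'.
Qed.

Definition xfrac (y : G) : Prop := exists p q, y = xprod p / xprod q.

Lemma xprod_cat p q : xprod (p ++ q) = xprod p * xprod q.
Proof. exact: big_cat. Qed.

Lemma xfrac_mul i y : xfrac y -> xfrac (xgen i * y).
Proof.
by move=> [p [q ->]]; exists (i :: p), q; rewrite xprod_cons mulgA.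
Qed.

(** This is an Ore condition: an inverse generator is moved rightwards through a positive product by
    means of [xgenJ], either cancelling or reaching the denominator. *)
Lemma xfrac_divl i y : xfrac y -> xfrac ((xgen i)^-1 * y).
Proof.
move=> [p [q ->]].
suff [p' [q' E]] : xfrac ((xgen i)^-1 * xprod p).
  by exists p', (q ++ q'); rewrite mulgA E xprod_cat invgM !mulgA.
elim: p i => [|j t IHt] i.
  by exists [::], [:: i]; rewrite xprod_nil xprod_cons xprod_nil !mulg1 mul1g.
rewrite xprod_cons mulgA; case: (ltngtP i j) => [ij|ji|->].
- have -> : (xgen i)^-1 * xgen j = xgen j.+1 / xgen i.
    by rewrite -(xgenJ ij) conjgE !mulgA mulgK.
  by rewrite -mulgA; apply: xfrac_mul; exact: IHt.
- have -> : (xgen i)^-1 * xgen j = xgen j / xgen i.+1.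
    by rewrite -(xgenJ ji) -conjVg conjgE mulVKg.
  by rewrite -mulgA; apply: xfrac_mul; exact: IHt.
- by exists t, [::]; rewrite mulVg xprod_nil invg1 mul1g mulg1.
Qed.

(** Each letter is rewritten through [b = x_1] and [a = x_0 / x_1], and fractions are stable under
    left multiplication by the [x_i] and their inverses. *)
Lemma xfrac_eval w : xfrac (eval (marking a b) w).
Proof.
elim: w => [|[i s] w IHw].
  by exists [::], [::]; rewrite eval_nil xprod_nil mulgV.
have x1 : xgen 1 = b by rewrite /xgen expg0 conjg1.
rewrite eval_cons /eval_letter /marking /=; move: (eval _ w) IHw => y IHy.
case: s; case: ifP => _.
- have -> : a^-1 * y = xgen 1 * ((xgen 0)^-1 * y).
    by rewrite x1 /xgen invgM !mulgA mulgV mul1g.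
  by apply: xfrac_mul; exact: xfrac_divl.
- by rewrite -x1; exact: xfrac_divl.
- have -> : a * y = xgen 0 * ((xgen 1)^-1 * y) by rewrite x1 /xgen mulgA mulgK.
  by apply: xfrac_mul; exact: xfrac_divl.
- by rewrite -x1; exact: xfrac_mul.
Qed.

End ThompsonGenerators.

(** * Morphisms out of presented groups and the relations of [thompsonF] *)

Lemma eval_comm_word (G : groupType) (n : nat) (s : 'I_n -> G) u v :
  eval s (comm_word u v) = [~ eval s u, eval s v].
Proof. by rewrite /comm_word !eval_cat !eval_inv_word. Qed.

Lemma eval_conj_word (G : groupType) (n : nat) (s : 'I_n -> G) u v :
  eval s (conj_word u v) = eval s u ^ eval s v.
Proof. by rewrite /conj_word !eval_cat eval_inv_word. Qed.

Lemma eval_wA (G : groupType) (f g : G) : eval (marking f g) wA = f.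
Proof. by rewrite eval_cons eval_nil mulg1. Qed.

Lemma eval_wB (G : groupType) (f g : G) : eval (marking f g) wB = g.
Proof. by rewrite eval_cons eval_nil mulg1. Qed.

Lemma presented_rel (n : nat) (rels : seq (word n)) (r : word n) :
  r \in rels -> \pi_(presented rels) r = 1.
Proof.
move=> rr; apply/presentedP; have := WordRel [::] [::] rr.
by rewrite !cat0s cats0.
Qed.

Section PresentedMorphism.
Variables (n : nat) (rels : seq (word n)) (G : groupType) (s : 'I_n -> G).
Hypothesis s_rels : forall r, r \in rels -> eval s r = 1.

Definition presented_eval (y : presented rels) : G := eval s (repr y).

Lemma presented_evalE w : presented_eval (\pi_(presented rels) w) = eval s w.
Proof. exact: (eval_word_equiv s_rels (repr_presented rels w)). Qed.

Lemma presented_evalM : {morph presented_eval : x y / x * y}.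
Proof.
move=> x y; rewrite -[x]reprK -[y]reprK [_ * _]presented_mulE !presented_evalE.
exact: eval_cat.
Qed.

End PresentedMorphism.

Definition thompsonA : thompsonF := \pi_thompsonF wA.
Definition thompsonB : thompsonF := \pi_thompsonF wB.

Lemma eval_thompson w : eval (marking thompsonA thompsonB) w = \pi_thompsonF w.
Proof.
rewrite -eval_presented_gen; apply: eq_eval_word => i; rewrite /marking.
case: eqP => [->|i0] //; congr (\pi _); congr [:: (_, _)].
case: i i0 => -[|[|//]] lti i0; apply: val_inj => //=.
by case: i0; apply: val_inj.
Qed.

Lemma thompson_rel1 : commute thompsonA (thompsonB ^ (thompsonA * thompsonB)).
Proof.
apply/commgP/eqP.
rewrite -[X in [~ X, _]](eval_wA thompsonA thompsonB).
rewrite -[X in [~ _, X ^ _]](eval_wB thompsonA thompsonB).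
rewrite -[X in [~ _, _ ^ (X * _)]](eval_wA thompsonA thompsonB).
rewrite -[X in [~ _, _ ^ (_ * X)]](eval_wB thompsonA thompsonB).
rewrite -eval_cat -eval_conj_word -eval_comm_word eval_thompson.
by apply: presented_rel; rewrite inE eqxx.
Qed.

Lemma thompson_rel2 :
  commute thompsonA (thompsonB ^ (thompsonA * thompsonB) ^+ 2).
Proof.
apply/commgP/eqP; rewrite expg2.
rewrite -[X in [~ X, _]](eval_wA thompsonA thompsonB).
rewrite -[X in [~ _, X ^ _]](eval_wB thompsonA thompsonB).
have -> : thompsonA * thompsonB = eval (marking thompsonA thompsonB) (wA ++ wB).
  by rewrite eval_cat eval_wA eval_wB.
rewrite -eval_cat -eval_conj_word -eval_comm_word eval_thompson.
by apply: presented_rel; rewrite !inE eqxx orbT.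
Qed.

(** * Action of homeomorphisms on the points of the interval *)

Section UnitInterval.
Variable R : realType.
Local Notation v := (@unitI_val R).
Implicit Types (f g : homeoI R) (x y : unitI R).

Lemma homeoI_ltE f x y : (v (f x) < v (f y))%R = (v x < v y)%R.
Proof.
have [_ of_] := homeoIP f.
have [/of_ -> //|yx|/val_inj ->] := ltrgtP (v x) (v y); last by rewrite !ltxx.
by apply/negbTE; rewrite -leNgt ltW // of_.
Qed.

Lemma homeoI_leE f x y : (v (f x) <= v (f y))%R = (v x <= v y)%R.
Proof. by rewrite !leNgt homeoI_ltE. Qed.

Lemma homeoI_mulE f g x : (f * g) x = f (g x). Proof. by []. Qed.

Lemma homeoI_invK f x : f^-1 (f x) = x.
Proof. by rewrite -homeoI_mulE mulVg. Qed.

Lemma homeoI_Kinv f x : f (f^-1 x) = x.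
Proof. by rewrite -homeoI_mulE mulgV. Qed.

Lemma homeoI_fix_inv f x : f x = x -> f^-1 x = x.
Proof. by move=> {1}<-; rewrite homeoI_invK. Qed.

Lemma homeoI_fixX f x n : f x = x -> (f ^+ n) x = x.
Proof.
by move=> fx; elim: n => [|n IHn]; rewrite ?expg0 // expgSr homeoI_mulE fx.
Qed.

Lemma homeoI_conjE f g x : (f ^ g) x = g^-1 (f (g x)).
Proof. by rewrite conjgE !homeoI_mulE. Qed.

(** The supports are separated by [x]; each map preserves both sides of [x], and on each side one of
    the two maps is the identity. *)
Lemma commute_fix f g x :
  (forall y, (v x <= v y)%R -> f y = y) ->
  (forall y, (v y <= v x)%R -> g y = y) -> commute f g.
Proof.
move=> fx gx; apply: homeoI_eq => y; rewrite !homeoI_mulE.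
have [yx|/ltW xy] := leP (v y) (v x).
  by rewrite !gx // -(fx x) // homeoI_leE.
by rewrite !fx // -(gx x) // homeoI_leE.
Qed.

(** * Chains of two homeomorphisms that generate Thompson's group *)

Section Chain.
Variables (A B : homeoI R) (a b c d : unitI R).
Hypotheses (ab : (v a < v b)%R) (bc : (v b < v c)%R) (cd : (v c < v d)%R).
Hypotheses (A_fixl : forall x, (v x <= v a)%R -> A x = x)
  (A_fixr : forall x, (v c <= v x)%R -> A x = x)
  (A_lt : forall x, (v a < v x < v c)%R -> (v (A x) < v x)%R).
Hypotheses (B_fixl : forall x, (v x <= v b)%R -> B x = x)
  (B_fixr : forall x, (v d <= v x)%R -> B x = x)
  (B_lt : forall x, (v b < v x < v d)%R -> (v (B x) < v x)%R).
Hypothesis AB_cb : (v (A (B c)) <= v b)%R.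

Let s : homeoI R := A * B.

Lemma chain_A_le x : (v (A x) <= v x)%R.
Proof.
have [/A_fixl ->//|ax] := leP (v x) (v a).
have [/A_fixr ->//|xc] := leP (v c) (v x).
by rewrite ltW // A_lt // ax.
Qed.

Lemma chain_s_lt x : (v a < v x < v d)%R -> (v (s x) < v x)%R.
Proof.
case/andP=> ax xd; rewrite homeoI_mulE; have [xb|bx] := leP (v x) (v b).
  by rewrite B_fixl // A_lt // ax (le_lt_trans xb).
by rewrite (le_lt_trans (chain_A_le _)) // B_lt // bx.
Qed.

Lemma chain_s_fixd : s d = d.
Proof. by rewrite homeoI_mulE B_fixr // A_fixr // ltW. Qed.

Lemma chain_s_fixa : s a = a.
Proof. by rewrite homeoI_mulE B_fixl ?A_fixl // ltW. Qed.

Lemma chain_sX_cb n : (v ((s ^+ n.+1)%g c) <= v b)%R.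
Proof.
elim: n => [|n IHn]; first exact: AB_cb.
rewrite expgS homeoI_mulE; apply: le_trans IHn.
set y := (s ^+ n.+1) c; apply/ltW/chain_s_lt; apply/andP; split.
  rewrite -(homeoI_fixX n.+1 chain_s_fixa) homeoI_ltE.
  exact: lt_trans bc.
by rewrite -(homeoI_fixX n.+1 chain_s_fixd) homeoI_ltE.
Qed.

(** The support of [A] lies left of [c]. Conjugation by [s ^+ n.+1] pushes the support of [B] to the
    right of [c], because [s ^+ n.+1] takes [c] to the left of [b]. *)
Lemma chain_commute n : commute A (B ^ s ^+ n.+1).
Proof.
apply: (@commute_fix _ _ c) => // y yc; rewrite homeoI_conjE B_fixl.
  by rewrite homeoI_invK.
by apply: le_trans (chain_sX_cb n); rewrite homeoI_leE.
Qed.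

(** The left end of the support of [x_i]: conjugation by [s ^+ j] carries the support [(b, d)] of
    [B] to [((s ^+ j)^-1 b, d)]. *)
Definition chain_left (i : nat) : unitI R :=
  if i is j.+1 then (s ^+ j)^-1 b else a.

Lemma chain_leftS i : chain_left i.+1 = (s ^+ i)^-1 b. Proof. by []. Qed.

Lemma chain_left_lt_d i : (v (chain_left i) < v d)%R.
Proof.
case: i => [|i]; first exact: lt_trans (lt_trans bc cd).
rewrite chain_leftS -(homeoI_fix_inv (homeoI_fixX i chain_s_fixd)) homeoI_ltE.
exact: lt_trans cd.
Qed.

Lemma chain_left_lt i : (v (chain_left i) < v (chain_left i.+1))%R.
Proof.
case: i => [|i]; first by rewrite chain_leftS expg0 invg1.
rewrite !chain_leftS expgS invgM homeoI_mulE homeoI_ltE.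
rewrite -(homeoI_ltE s) homeoI_Kinv.
by rewrite chain_s_lt // ab (lt_trans bc).
Qed.

Lemma chain_left_le i j :
  (i <= j)%N -> (v (chain_left i) <= v (chain_left j))%R.
Proof.
move/subnK <-; elim: (j - i)%N => // k IHk.
by rewrite addSn (le_trans IHk) // ltW // chain_left_lt.
Qed.

Lemma xgen_fix i x :
  (v x <= v (chain_left i))%R -> xgen A B i x = x.
Proof.
case: i => [|i] xi.
  by rewrite homeoI_mulE B_fixl ?A_fixl // (le_trans xi) // ltW.
rewrite [xgen _ _ _]/(B ^ s ^+ i) homeoI_conjE B_fixl ?homeoI_invK //.
by rewrite -(homeoI_leE (s ^+ i)^-1) homeoI_invK -chain_leftS.
Qed.

Lemma xgen_lt i x :
  (v (chain_left i) < v x < v d)%R -> (v (xgen A B i x) < v x)%R.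
Proof.
case: i => [|i]; first exact: chain_s_lt.
rewrite chain_leftS => /andP[ix xd].
rewrite [xgen _ _ _]/(B ^ s ^+ i) homeoI_conjE.
rewrite -(homeoI_ltE (s ^+ i)) homeoI_Kinv.
apply: B_lt; rewrite -(homeoI_ltE (s ^+ i)^-1) homeoI_invK ix /=.
by rewrite -(homeoI_fixX i chain_s_fixd) homeoI_ltE.
Qed.

Lemma xprod_fix i l x :
  all (leq i) l -> (v x <= v (chain_left i))%R -> xprod A B l x = x.
Proof.
move=> + xi; elim: l => [|j l IHl] /=; first by rewrite xprod_nil.
case/andP=> ij il; rewrite xprod_cons homeoI_mulE IHl // xgen_fix //.
exact: le_trans (chain_left_le ij).
Qed.

Lemma xprod_le i l x :
  all (leq i) l -> (v (chain_left i) < v x < v d)%R ->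
  (v (chain_left i) < v (xprod A B l x) <= v x)%R.
Proof.
move=> + /andP[ix xd]; elim: l => [|j l IHl] /=.
  by rewrite xprod_nil ix /=.
case/andP=> ij /IHl/andP[]; rewrite xprod_cons homeoI_mulE.
set y := xprod A B l x => iy yx; apply/andP; split.
  by rewrite -(xgen_fix (chain_left_le ij)) homeoI_ltE.
have [/xgen_fix ->//|jy] := leP (v y) (v (chain_left j)).
by rewrite (le_trans (ltW (xgen_lt _))) // jy (le_lt_trans yx).
Qed.

(** The two products differ at the left end of the support of [x_(i+1)]: the right one fixes this
    point, whereas on the left [l] does not move it right and [x_i] then moves it strictly left. *)
Lemma xprod_neq i l l' :
  all (leq i) l -> all (leq i.+1) l' -> xprod A B (i :: l) <> xprod A B l'.
Proof.
move=> il il' /(congr1 (fun h : homeoI R => v (h (chain_left i.+1)))).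
rewrite (xprod_fix il') // xprod_cons homeoI_mulE; apply/eqP; rewrite lt_eqF //.
have := @xprod_le i l (chain_left i.+1) il.
rewrite chain_left_lt chain_left_lt_d => /(_ isT).
case/andP=> iy yx; rewrite (lt_le_trans (xgen_lt _) yx) // iy /=.
exact: le_lt_trans (chain_left_lt_d i.+1).
Qed.

(** The heads are compared: different heads contradict [xprod_neq], the smaller one playing the role
    of [i], and equal heads cancel. *)
Lemma xprod_sorted_inj l l' :
  sorted leq l -> sorted leq l' -> xprod A B l = xprod A B l' -> l = l'.
Proof.
have ltr := leq_trans; have all_lt i j t : (i < j)%N -> all (leq j) t ->
    all (leq i.+1) (j :: t).
  move=> ij /= jt; rewrite ij /=; apply: sub_all jt => k; exact: leq_trans.
elim: l l' => [|i t IHt] [|j t'] //; rewrite /= ?path_sortedE //.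
- by move=> _ /andP[jt' _] /esym/(@xprod_neq j t' [::] jt' isT).
- by move=> /andP[it _] _ /(@xprod_neq i t [::] it isT).
move=> /andP[it st] /andP[jt' st'].
case: (ltngtP i j) => [ij|ji|<-].
- by move/(xprod_neq it (all_lt _ _ _ ij jt')).
- by move/esym/(xprod_neq jt' (all_lt _ _ _ ji it)).
- by rewrite !xprod_cons => /mulgI /(IHt _ st st') ->.
Qed.

Theorem chain_isomorphic_thompson :
  isomorphic (subgroup (generated [set A; B])) thompsonF.
Proof.
set rels := [:: comm_word wA (conj_word wB (wA ++ wB));
  comm_word wA (conj_word wB ((wA ++ wB) ++ (wA ++ wB)))].
have rels1 r : r \in rels -> eval (marking A B) r = 1.
  rewrite !inE => /orP[|] /eqP ->; apply/eqP;
    rewrite eval_comm_word eval_conj_word !eval_cat eval_wA eval_wB;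
    apply/commgP.
    exact: (chain_commute 0).
  by rewrite -expg2; exact: (chain_commute 1).
pose hM := isMultiplicative.Build _ _ _ (presented_evalM rels1).
have h1 : presented_eval (marking A B) (1 : thompsonF) = 1.
  by rewrite (presented_evalE rels1) eval_nil.
pose h1M := Multiplicative_isUMagmaMorphism.Build _ _ _ h1.
pose h : UMagmaMorphism.type thompsonF (homeoI R) :=
  HB.pack (presented_eval (rels := rels) (marking A B)) hM h1M.
have h_pi w : h (\pi_thompsonF w) = eval (marking A B) w.
  exact: presented_evalE.
have hA : h thompsonA = A by rewrite h_pi eval_wA.
have hB : h thompsonB = B by rewrite h_pi eval_wB.
have h_xprod l : h (xprod thompsonA thompsonB l) = xprod A B l.
  rewrite gmulf_prod; apply: eq_bigr => -[|i] _; rewrite /xgen.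
    by rewrite gmulfM hA hB.
  by rewrite gmulfJ gmulfXn gmulfM hA !hB.
refine (@isomorphic_generated _ A B _ h _ _) => [|x].
  (* An element of the kernel is a fraction of two sorted products with equal images, so the two
     index lists coincide and the fraction is trivial. *)
  apply: gmulf_inj => x; rewrite -[x]reprK -eval_thompson.
  have [p [q ->]] := xfrac_eval thompson_rel1 thompson_rel2 (repr x).
  have [p' sp' ->] := xprod_sorted thompson_rel1 thompson_rel2 p.
  have [q' sq' ->] := xprod_sorted thompson_rel1 thompson_rel2 q.
  rewrite gmulfF !h_xprod => /divg1_eq/(xprod_sorted_inj sp' sq') ->.
  exact: mulgV.
split=> [/generatedP[w ->]|[y <-]].
  by exists (\pi_thompsonF w); exact: h_pi.
by apply/generatedP; exists (repr y); rewrite -h_pi reprK.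
Qed.

End Chain.
End UnitInterval.

(** * Piecewise linear maps of the line and their restriction to the interval *)

Section RealMaps.
Variable R : realType.
Local Open Scope ring_scope.

Implicit Types p q m : R.

(* Piecewise linear, with support [(p, q)] and [m] mapped to [m']. *)
Definition bump (p m m' q x : R) : R :=
  if x <= p then x
  else if x <= m then p + (x - p) * ((m' - p) / (m - p))
  else if x <= q then q - (q - x) * ((q - m') / (q - m))
  else x.

Lemma bump_left_bounds p m m' x : p < m -> p < m' ->
  p < x <= m -> p < p + (x - p) * ((m' - p) / (m - p)) <= m'.
Proof.
move=> pm pm' /andP[px xm]; rewrite mulrA ltrDl divr_gt0
  ?mulr_gt0 ?subr_gt0 //=.
rewrite -lerBrDl ler_pdivrMr ?subr_gt0 // mulrC ler_pM2l ?subr_gt0 //.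
by rewrite lerD2r.
Qed.

Lemma bump_right_bounds m m' q x : m < q -> m' < q ->
  m < x <= q -> m' < q - (q - x) * ((q - m') / (q - m)) <= q.
Proof.
move=> mq m'q /andP[mx xq].
have : 0 <= (q - x) * ((q - m') / (q - m)).
  apply: mulr_ge0; first by rewrite subr_ge0.
  by apply: divr_ge0; rewrite subr_ge0 ltW.
have : (q - x) * ((q - m') / (q - m)) < q - m'.
  rewrite mulrCA -[ltRHS]mulr1 ltr_pM2l ?subr_gt0 // ltr_pdivrMr ?subr_gt0 //.
  by rewrite mul1r; lra.
by lra.
Qed.

Lemma bump_lt p m m' q : p < m -> m < q -> p < m' -> m' < q ->
  {homo bump p m m' q : x y / x < y}.
Proof.
move=> pm mq pm' m'q x y xy; rewrite /bump.
have kl : 0 < (m' - p) / (m - p) by rewrite divr_gt0 ?subr_gt0.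
have kr : 0 < (q - m') / (q - m) by rewrite divr_gt0 ?subr_gt0.
have xyl := mulr_gt0 kl (eqbRL (subr_gt0 x y) xy).
have xyr := mulr_gt0 kr (eqbRL (subr_gt0 x y) xy).
have bl z := @bump_left_bounds p m m' z pm pm'.
have br z := @bump_right_bounds m m' q z mq m'q.
move: ((m' - p) / (m - p)) ((q - m') / (q - m)) => k l in kl kr xyl xyr bl br *.
case: (leP x p) => xp; case: (leP y p) => yp; try lra.
  case: (leP y m) => ym; last first.
    case: (leP y q) => yq; last by lra.
    by have /andP[] := br y (introT andP (conj ym yq)); lra.
  by have /andP[] := bl y (introT andP (conj yp ym)); lra.
case: (leP x m) => xm.
  have /andP[x1 x2] := bl x (introT andP (conj xp xm)).
  case: (leP y m) => ym; first by lra.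
  case: (leP y q) => yq; last by lra.
  by have /andP[] := br y (introT andP (conj ym yq)); lra.
case: (leP y m) => ym; first by lra.
case: (leP x q) => xq; last by case: (leP y q); lra.
have /andP[x1 x2] := br x (introT andP (conj xm xq)).
by case: (leP y q) => yq; lra.
Qed.

Lemma bump_outside p m m' q x :
  m < q -> x <= p \/ q <= x -> bump p m m' q x = x.
Proof.
move=> mq; rewrite /bump; case: leP => // px [|qx]; first by lra.
rewrite leNgt (lt_le_trans mq qx) /=; case: leP => // xq.
have -> : x = q by lra.
by rewrite subrr mul0r subr0.
Qed.

Lemma bump_left p m m' q x :
  p <= x <= m -> bump p m m' q x = p + (x - p) * ((m' - p) / (m - p)).
Proof.
case/andP=> px xm; rewrite /bump xm; case: leP => // xp.
have -> : x = p by lra.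
by rewrite subrr mul0r addr0.
Qed.

Lemma bump_right p m m' q x : p < m -> m < q ->
  m <= x <= q -> bump p m m' q x = q - (q - x) * ((q - m') / (q - m)).
Proof.
move=> pm mq /andP[mx xq]; rewrite /bump xq leNgt (lt_le_trans pm mx) /=.
case: leP => // xm; have -> : x = m by lra.
have mp0 : m - p != 0 by lra.
have qm0 : q - m != 0 by lra.
by field; rewrite qm0 mp0.
Qed.

Lemma bump_lt_id p m m' q x : p < m -> m < q -> m' < m ->
  p < x < q -> bump p m m' q x < x.
Proof.
move=> pm mq m'm /andP[px xq]; case: (leP x m) => xm.
  rewrite bump_left; last by rewrite ltW.
  rewrite -ltrBrDl -[ltRHS]mulr1 ltr_pM2l ?subr_gt0 //.
  by rewrite ltr_pdivrMr ?subr_gt0 // mul1r ltrD2r.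
rewrite bump_right ?(ltW xm) ?(ltW xq) //.
rewrite ltrBlDr -ltrBlDl -[ltLHS]mulr1 ltr_pM2l ?subr_gt0 //.
by rewrite ltr_pdivlMr ?subr_gt0 // mul1r ltrD2l ltrN2.
Qed.

Lemma bumpK p m m' q : p < m -> m < q -> p < m' -> m' < q ->
  cancel (bump p m m' q) (bump p m' m q).
Proof.
move=> pm mq pm' m'q x.
have [mp0 m'p0] : m - p != 0 /\ m' - p != 0 by split; lra.
have [qm0 qm'0] : q - m != 0 /\ q - m' != 0 by split; lra.
case: (leP x p) => xp; first by rewrite !bump_outside //; left.
case: (leP q x) => qx; first by rewrite !bump_outside //; right.
case: (leP x m) => xm.
  rewrite (bump_left _ _ (x := x)) ?xm ?(ltW xp) //.
  have /andP[b1 b2] := bump_left_bounds pm pm' (introT andP (conj xp xm)).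
  by rewrite bump_left ?b2 ?ltW //; field; rewrite mp0 m'p0.
rewrite (bump_right _ pm mq (x := x)) ?(ltW xm) ?(ltW qx) //.
have /andP[b1 b2] := bump_right_bounds mq m'q (introT andP (conj xm (ltW qx))).
by rewrite bump_right ?b2 ?ltW //; field; rewrite qm0 qm'0.
Qed.

Lemma increasing_can_continuous (h k : R -> R) :
  {homo h : x y / x < y} -> {homo k : x y / x < y} ->
  cancel h k -> cancel k h -> continuous h.
Proof.
move=> h_lt k_lt hK kK x; apply/cvgrPdist_lt => e e0.
(* Monotonicity makes this interval the preimage under [h] of the ball of radius [e] around
   [h x]. *)
have xI : x \in `]k (h x - e), k (h x + e)[.
  by rewrite in_itv /= -{2 3}(hK x) !k_lt //; lra.
near=> y.
have : y \in `]k (h x - e), k (h x + e)[ by near: y; exact: near_in_itvoo.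
rewrite in_itv /= => /andP[/h_lt + /h_lt]; rewrite !kK => ? ?.
by rewrite ltr_norml; apply/andP; split; lra.
Unshelve. all: by end_near. Qed.

Local Notation v := (@unitI_val R).

Lemma unitI_ge0 (x : unitI R) : 0 <= v x.
Proof. by have := set_valP x; rewrite /= in_itv => /andP[]. Qed.

Lemma unitI_le1 (x : unitI R) : v x <= 1.
Proof. by have := set_valP x; rewrite /= in_itv => /andP[]. Qed.

Lemma unitI_inj : injective v.
Proof. exact: val_inj. Qed.

Lemma unitI_point (r : R) : 0 <= r <= 1 -> {x : unitI R | v x = r}.
Proof.
move=> r01; have rI : r \in (`[0, 1]%classic : set R).
  by rewrite inE /= in_itv.
by exists (SigSub rI).
Qed.

Lemma homeoI_of_increasing (h k : R -> R) :
  {homo h : x y / x < y} -> {homo k : x y / x < y} ->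
  cancel h k -> cancel k h -> h 0 = 0 -> h 1 = 1 ->
  {f : homeoI R | forall x, v (f x) = h (v x)}.
Proof.
move=> h_lt k_lt hK kK h0 h1.
have k0 : k 0 = 0 by rewrite -h0 hK.
have k1 : k 1 = 1 by rewrite -h1 hK.
have lift (l : R -> R) : {homo l : x y / x < y} -> l 0 = 0 -> l 1 = 1 ->
    {f : unitI R -> unitI R | forall x, v (f x) = l (v x)}.
  move=> /ltW_homo l_le l0 l1.
  have l01 x : 0 <= l (v x) <= 1.
    by rewrite -{1}l0 -l1 !l_le // ?unitI_ge0 ?l1 ?unitI_le1.
  by exists (fun x => sval (unitI_point (l01 x))) => x; case: unitI_point.
have [f fE] := lift h h_lt h0 h1; have [g gE] := lift k k_lt k0 k1.
have cont (l : R -> R) (u : unitI R -> unitI R) : continuous l ->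
    (forall x, v (u x) = l (v x)) -> continuous u.
  move=> cl uE; apply: continuous_comp_initial.
  rewrite [X in continuous X](_ : _ = l \o set_val); last exact/funext.
  by move=> x; apply: continuous_comp; [exact: initial_continuous|exact: cl].
suff fP : `[< homeomorphism f /\ orientation_preserving f >].
  by exists (HomeoI fP).
apply/asboolP; split; last by move=> x y xy; rewrite !fE h_lt.
split; first exact: (cont _ _ (increasing_can_continuous h_lt k_lt hK kK)).
exists g; split=> [x|x|].
- by apply: unitI_inj; rewrite gE fE hK.
- by apply: unitI_inj; rewrite fE gE kK.
- exact: (cont _ _ (increasing_can_continuous k_lt h_lt kK hK)).
Qed.

Lemma homeoI_bump p m m' q :
  0 <= p -> q <= 1 -> p < m -> m < q -> p < m' -> m' < q ->
  {f : homeoI R | forall x, v (f x) = bump p m m' q (v x)}.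
Proof.
move=> p0 q1 pm mq pm' m'q; apply: (@homeoI_of_increasing _ (bump p m' m q)).
- exact: bump_lt.
- exact: bump_lt.
- exact: bumpK.
- exact: bumpK.
- by rewrite bump_outside //; left.
- by rewrite bump_outside //; right.
Qed.

End RealMaps.

Section EvalMarking.
Variables (G : groupType) (f g : G).
Local Notation ev := (eval (marking f g)).

Lemma eval_f w : ev ((ord0, false) :: w) = f * ev w.
Proof. by rewrite eval_cons. Qed.

Lemma eval_fV w : ev ((ord0, true) :: w) = f^-1 * ev w.
Proof. by rewrite eval_cons. Qed.

Lemma eval_g w : ev ((ord_max, false) :: w) = g * ev w.
Proof. by rewrite eval_cons. Qed.

Lemma eval_gV w : ev ((ord_max, true) :: w) = g^-1 * ev w.
Proof. by rewrite eval_cons. Qed.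

End EvalMarking.

(** * Root pairs: how their relations determine [t], and why they are square roots of [F] *)

Section Roots.
Variable R : realType.
Local Notation v := (@unitI_val R).
Implicit Types (f g V W : homeoI R) (a b c d x y : unitI R).

Lemma homeoI_fix0 f x : v x = 0%R -> f x = x.
Proof.
have fix_le (h : homeoI R) z : v z = 0%R -> (v (h z) <= v z)%R.
  move=> z0; rewrite -{2}(homeoI_Kinv h z) homeoI_leE z0; exact: unitI_ge0.
move=> x0; apply/unitI_inj/eqP; rewrite eq_le fix_le // x0; exact: unitI_ge0.
Qed.

Lemma homeoI_fix1 f x : v x = 1%R -> f x = x.
Proof.
have fix_ge (h : homeoI R) z : v z = 1%R -> (v z <= v (h z))%R.
  move=> z1; rewrite -{1}(homeoI_Kinv h z) homeoI_leE z1; exact: unitI_le1.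
move=> x1; apply/unitI_inj/eqP; rewrite eq_le fix_ge // x1 andbT.
exact: unitI_le1.
Qed.

Lemma homeoI_gt0 f x : (0 < v (f x))%R = (0 < v x)%R.
Proof.
have [zero zeroE] : {x : unitI R | v x = 0%R}.
  by apply: unitI_point; rewrite lexx ler01.
by rewrite -zeroE -{1}(homeoI_fix0 f zeroE) homeoI_ltE.
Qed.

Lemma homeoI_lt1 f x : (v (f x) < 1)%R = (v x < 1)%R.
Proof.
have [one oneE] : {x : unitI R | v x = 1%R}.
  by apply: unitI_point; rewrite lexx ler01.
by rewrite -oneE -{1}(homeoI_fix1 f oneE) homeoI_ltE.
Qed.

(** With [U] and [W] the values of [u] and [w], this is the commutator of [U f U^-1] and [W g W^-1];
    for root pairs it is trivial exactly when [U (2/3) <= W (1/3)]. *)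
Definition chain_test (u w : word 2) : word 2 :=
  comm_word (conj_word wA (inv_word u)) (conj_word wB (inv_word w)).

Lemma eval_chain_test (G : groupType) (f g : G) u w :
  eval (marking f g) (chain_test u w) = 1 <->
  commute (f ^ (eval (marking f g) u)^-1) (g ^ (eval (marking f g) w)^-1).
Proof.
rewrite eval_comm_word !eval_conj_word !eval_inv_word eval_wA eval_wB.
by split=> [/eqP/commgP|/commgP/eqP].
Qed.

Lemma commute_conj_iff f g V W b c :
  (0 < v b < 1)%R -> (0 < v c < 1)%R ->
  (forall x, (v c <= v x)%R -> f x = x) ->
  (forall x, (0 < v x < v c)%R -> (v (f x) < v x)%R) ->
  (forall x, (v x <= v b)%R -> g x = x) ->
  (forall x, (v b < v x < 1)%R -> (v (g x) < v x)%R) ->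
  commute (f ^ V^-1) (g ^ W^-1) <-> (v (V c) <= v (W b))%R.
Proof.
move=> /andP[b0 b1] /andP[c0 c1] f_fix f_lt g_fix g_lt.
have conjE (h U : homeoI R) x : (h ^ U^-1) x = U (h (U^-1 x)).
  by rewrite homeoI_conjE invgK.
have gW_fix x : (v x <= v (W b))%R -> (g ^ W^-1) x = x.
  move=> xb; rewrite conjE g_fix ?homeoI_Kinv //.
  by rewrite -(homeoI_leE W) homeoI_Kinv.
split=> [fg|cb]; last first.
  apply: (@commute_fix _ _ _ (V c)) => x xc.
    by rewrite conjE f_fix ?homeoI_Kinv // -(homeoI_leE V) homeoI_Kinv.
  by apply: gW_fix; exact: le_trans cb.
rewrite leNgt; apply/negP => bc.
(* [g ^ W^-1] fixes [W b], hence also its preimage [y] under [f ^ V^-1], which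
   lies beyond [W b], where [g ^ W^-1] has no fixed point *)
set y := (f ^ V^-1)^-1 (W b).
have fyE : (f ^ V^-1) y = W b by rewrite homeoI_Kinv.
have gyE : (g ^ W^-1) y = y.
  have gWb := gW_fix _ (lexx (v (W b))).
  rewrite -{1}gWb in fyE.
  by rewrite /y -homeoI_mulE (commuteV (commute_sym fg)) homeoI_mulE gWb.
have Wy : (v (W b) < v y)%R.
  rewrite -(homeoI_ltE (f ^ V^-1)) fyE conjE -(homeoI_ltE V^-1) homeoI_invK.
  by apply: f_lt; rewrite !homeoI_gt0 b0 -(homeoI_ltE V) homeoI_Kinv.
have y1 : (v y < 1)%R by rewrite !homeoI_lt1.
have : (v (W^-1%g ((g ^ W^-1)%g y)) < v (W^-1%g y))%R.
  rewrite conjE homeoI_invK; apply: g_lt.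
  by rewrite homeoI_lt1 y1 -{1}(homeoI_invK W b) homeoI_ltE Wy.
by rewrite gyE ltxx.
Qed.

Local Open Scope ring_scope.

(* On [[1/3, 2/3]] the maps [g^-1], left of [5/9], and [f], right of [5/9],
   expand by [3/2] independently of [t]; [f] moves the point
   [1/2 = g^-1 (f^-1 (1/3))] to [t]. *)
Record root_pair (t : R) f g : Prop := RootPair {
  root_f_fix x : 2 / 3 <= v x -> f x = x;
  root_f_lt x : 0 < v x < 2 / 3 -> v (f x) < v x;
  root_f_le x : 4 / 9 <= v x <= 2 / 3 -> v (f x) <= 3 / 2 * v x - 1 / 3;
  root_f_affine x : 5 / 9 <= v x <= 2 / 3 -> v (f x) = 3 / 2 * v x - 1 / 3;
  root_f_third x : v x = 4 / 9 -> v (f x) = 1 / 3;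
  root_f_half x : v x = 1 / 2 -> v (f x) = t;
  root_g_fix x : v x <= 1 / 3 -> g x = x;
  root_g_lt x : 1 / 3 < v x < 1 -> v (g x) < v x;
  root_g_affine x : 1 / 3 <= v x <= 2 / 3 -> v (g x) = 2 / 3 * v x + 1 / 9
}.

Lemma root_pair_exists (t : R) :
  1 / 3 < t < 5 / 12 -> exists f g, root_pair t f g.
Proof.
case/andP=> t1 t2.
(* Right of [4/9] the map [f0] has slope [(1/3) / (2/9) = 3/2], and it sends [1/2] to [5/12] and
   [5/9] to [1/2]. *)
have [f0 f0E] : {f : homeoI R | forall x,
    v (f x) = bump 0 (4 / 9) (1 / 3) (2 / 3) (v x)}.
  by apply: homeoI_bump; lra.
(* The correction [k] takes [5/12 = f0 (1/2)] to [t]. Being supported in [(1/3, 1/2)], it leaves the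
   values of [f0] at [4/9] and right of [5/9] unchanged; it moves points left as [t < 5/12]. *)
have [k kE] : {f : homeoI R | forall x,
    v (f x) = bump (1 / 3) (5 / 12) t (1 / 2) (v x)}.
  by apply: homeoI_bump; lra.
have [g gE] : {f : homeoI R | forall x,
    v (f x) = bump (1 / 3) (2 / 3) (5 / 9) 1 (v x)}.
  by apply: homeoI_bump; lra.
have k_out x : v x <= 1 / 3 \/ 1 / 2 <= v x -> v (k x) = v x.
  by move=> xo; rewrite kE bump_outside //; lra.
have k_le x : v (k x) <= v x.
  case: (leP (v x) (1 / 3)) => x1; first by rewrite k_out //; left.
  case: (leP (1 / 2) (v x)) => x2; first by rewrite k_out //; right.
  by rewrite kE ltW // bump_lt_id //; lra.
have f0_right x : 4 / 9 <= v x <= 2 / 3 -> v (f0 x) = 3 / 2 * v x - 1 / 3.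
  by move=> xI; rewrite f0E bump_right; [field; lra|lra..].
exists (k * f0)%g, g; split=> x xI; rewrite ?homeoI_mulE.
- apply: unitI_inj; have f0x : v (f0 x) = v x.
    by rewrite f0E bump_outside //; [lra|right].
  by rewrite k_out f0x //; right; lra.
- by apply: le_lt_trans (k_le _) _; rewrite f0E bump_lt_id //; lra.
- by apply: le_trans (k_le _) _; rewrite f0_right.
- have f0x : v (f0 x) = 3 / 2 * v x - 1 / 3 by apply: f0_right; lra.
  by rewrite k_out f0x //; right; lra.
- have f0x : v (f0 x) = 1 / 3 by rewrite f0_right xI; lra.
  by rewrite k_out f0x //; left.
- rewrite kE f0_right xI; last by lra.
  by rewrite bump_left; [field; lra|lra].
- by apply: unitI_inj; rewrite gE bump_outside //; [lra|left].
- by rewrite gE bump_lt_id //; lra.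
- by rewrite gE bump_left; [field; lra|lra].
Qed.

(** The interval [(p, q)] is expanded by [3/2], through [g^-1] or [f], until it contains
    [5/9 = g (2/3)]. It stays inside [[1/3, 2/3]], so its length never exceeds [1/3], which bounds
    the number of expansions. The choices depend on [p] and [q] only, so [w] serves every [t]. *)
Lemma root_orbit_dense_rec n (p q : R) :
  1 / 3 <= p -> p < q -> q <= 2 / 3 -> 1 / 3 < (3 / 2) ^+ n * (q - p) ->
  exists w, forall t f g x, root_pair t f g -> v x = 2 / 3 ->
    p < v (eval (marking f g) w x) < q.
Proof.
elim: n p q => [|n IHn] p q p1 pq q2 npq.
  by move: npq; rewrite expr0; lra.
case: (leP q (5 / 9)) => q5.
  (* The new endpoints are the images of [p] and [q] under [g^-1]. *)
  have [||||w wP] := IHn (3 / 2 * p - 1 / 6) (3 / 2 * q - 1 / 6); try lra.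
    by move: npq; rewrite exprSr; lra.
  exists ((ord_max, false) :: w) => t f g x rt xE.
  have /andP[w1 w2] := wP t f g x rt xE.
  rewrite eval_g homeoI_mulE (root_g_affine rt); lra.
case: (leP (5 / 9) p) => p5.
  (* Here the affine branch of [f] is applied to the endpoints, and [f^-1] brings the orbit point
     back. *)
  have [||||w wP] := IHn (3 / 2 * p - 1 / 3) (3 / 2 * q - 1 / 3); try lra.
    by move: npq; rewrite exprSr; lra.
  exists ((ord0, true) :: w) => t f g x rt xE.
  have /andP[] := wP t f g x rt xE.
  rewrite eval_fV homeoI_mulE.
  move: (homeoI_fun (eval _ w) x) => y w1 w2.
  have [z zE] : {z : unitI R | v z = 2 / 3 * v y + 2 / 9}.
    by apply: unitI_point; lra.
  have -> : y = f z by apply: unitI_inj; rewrite (root_f_affine rt) zE; lra.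
  by rewrite homeoI_invK zE; lra.
exists [:: (ord_max, false)] => t f g x rt xE.
by rewrite eval_wB (root_g_affine rt) xE; lra.
Qed.

Lemma root_orbit_dense (p q : R) :
  1 / 3 <= p -> p < q -> q <= 2 / 3 ->
  exists w, forall t f g x, root_pair t f g -> v x = 2 / 3 ->
    p < v (eval (marking f g) w x) < q.
Proof.
move=> p1 pq q2.
have [n npq] : exists n, 1 / 3 < (3 / 2) ^+ n * (q - p).
  have qp : 0 < q - p by lra.
  have powge n : n%:R / 2 <= (3 / 2 : R) ^+ n.
    elim: n => [|n IHn]; first by rewrite mul0r expr0.
    have pow1 : 1 <= (3 / 2 : R) ^+ n by apply: exprn_ege1; lra.
    by rewrite exprS -[n.+1]addn1 natrD; lra.
  (* For this [n], [n * (q - p) > 1], so the linear bound [n / 2] on the power yields more than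
     [1/2], hence more than [1/3]. *)
  exists (Num.bound (q - p)^-1).
  apply: lt_le_trans (ler_wpM2r (ltW qp) (powge _)).
  have : 1 < (Num.bound (q - p)^-1)%:R * (q - p).
    rewrite -ltr_pdivrMr // div1r; apply: archi_boundP.
    by rewrite invr_ge0 ltW.
  by lra.
exact: root_orbit_dense_rec npq.
Qed.

(** The word [f g^-1 f^-1], which takes [1/3] to [4/9], then to [1/2], then to [t]. *)
Definition half_word : word 2 :=
  [:: (ord0, false); (ord_max, true); (ord0, true)].

Lemma root_half_word t f g x :
  root_pair t f g -> v x = 1 / 3 -> v (eval (marking f g) half_word x) = t.
Proof.
move=> rt xE; rewrite eval_f eval_gV eval_fV eval_nil mulg1 !homeoI_mulE.
apply: (root_f_half rt).
have [y yE] : {y : unitI R | v y = 4 / 9} by apply: unitI_point; lra.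
have [z zE] : {z : unitI R | v z = 1 / 2} by apply: unitI_point; lra.
have -> : x = f y by apply: unitI_inj; rewrite (root_f_third rt) ?xE.
rewrite homeoI_invK.
have -> : y = g z.
  by apply: unitI_inj; rewrite (root_g_affine rt) ?yE zE; lra.
by rewrite homeoI_invK.
Qed.

(** A single word [w] sends [2/3] strictly between [t] and [t'] for both pairs. Testing it against
    [half_word] gives a relation for the pair of [t'] but not for that of [t]. *)
Lemma root_pair_kernel_neq t t' f g f' g' :
  1 / 3 < t -> t < t' -> t' < 5 / 12 -> root_pair t f g -> root_pair t' f' g' ->
  [set w | eval (marking f g) w = 1%g] <>
  [set w | eval (marking f' g') w = 1%g].
Proof.
move=> t1 tt' t2 rt rt'.
have [|w wP] := root_orbit_dense (ltW t1) tt'; first by lra.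
have [b bE] : {x : unitI R | v x = 1 / 3} by apply: unitI_point; lra.
have [c cE] : {x : unitI R | v x = 2 / 3} by apply: unitI_point; lra.
have testP s h k : root_pair s h k ->
    eval (marking h k) (chain_test w half_word) = 1%g <->
    v (eval (marking h k) w c) <= s.
  move=> rs; rewrite eval_chain_test -(root_half_word rs bE).
  apply: commute_conj_iff; rewrite ?bE ?cE; try lra.
  - exact: root_f_fix rs.
  - exact: root_f_lt rs.
  - exact: root_g_fix rs.
  - exact: root_g_lt rs.
move=> /seteqP[_ /(_ (chain_test w half_word))] /=.
have /andP[+ _] := wP _ _ _ _ rt cE; have /andP[_ /ltW] := wP _ _ _ _ rt' cE.
move=> /(testP _ _ _ rt') w1 + /(_ w1)/(testP _ _ _ rt).
by rewrite ltNge => /negP.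
Qed.

Lemma root_pair_square_root t f g :
  root_pair t f g -> square_root_F (generated [set f; g]).
Proof.
move=> rt.
have [a aE] : {x : unitI R | v x = 0} by apply: unitI_point; lra.
have [b bE] : {x : unitI R | v x = 1 / 3} by apply: unitI_point; lra.
have [c cE] : {x : unitI R | v x = 2 / 3} by apply: unitI_point; lra.
have [d dE] : {x : unitI R | v x = 1} by apply: unitI_point; lra.
have f_fix0 x : v x <= v a -> f x = x.
  rewrite aE => x0; apply: homeoI_fix0; apply/eqP; rewrite eq_le x0.
  exact: unitI_ge0.
have g_fix1 x : v d <= v x -> g x = x.
  rewrite dE => x1; apply: homeoI_fix1; apply/eqP; rewrite eq_le x1 andbT.
  exact: unitI_le1.
have f_le x : v (f x) <= v x.
  case: (leP (v x) 0) => [|x0]; first by rewrite -aE => /f_fix0 ->.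
  case: (leP (2 / 3) (v x)) => [/(root_f_fix rt) -> //|xc].
  by apply/ltW/(root_f_lt rt); rewrite x0.
have g_le x : v (g x) <= v x.
  case: (leP (v x) (1 / 3)) => [/(root_g_fix rt) -> //|x0].
  case: (leP 1 (v x)) => [|x1]; first by rewrite -dE => /g_fix1 ->.
  by apply/ltW/(root_g_lt rt); rewrite x0.
have sf : supp f = [set x | v a < v x < v c].
  apply/seteqP; split=> x /=.
    move=> fx; rewrite !ltNge; apply/andP; split; apply/negP.
      by move=> /f_fix0.
    by rewrite cE => /(root_f_fix rt).
  by rewrite aE cE => /(root_f_lt rt) + fx; rewrite fx ltxx.
have sg : supp g = [set x | v b < v x < v d].
  apply/seteqP; split=> x /=.
    move=> gx; rewrite !ltNge; apply/andP; split; apply/negP.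
      by rewrite bE => /(root_g_fix rt).
    by move=> /g_fix1.
  by rewrite bE dE => /(root_g_lt rt) + gx; rewrite gx ltxx.
have sfg : supp f `&` supp g = [set x | v b < v x < v c].
  rewrite sf sg aE bE cE dE; apply/seteqP; split=> x /=.
    by move=> [/andP[_ ->] /andP[-> _]].
  by move=> xI; split; lra.
have ggc : v (g (g c)) = 13 / 27.
  have gc : v (g c) = 5 / 9 by rewrite (root_g_affine rt) cE; lra.
  by rewrite (root_g_affine rt) gc; lra.
have [e eE] : {x : unitI R | v x = 4 / 9} by apply: unitI_point; lra.
exists f, g; split=> //.
  rewrite !expg2; apply: (@chain_isomorphic_thompson _ _ _ a b c d).
  - by rewrite aE bE; lra.
  - by rewrite bE cE; lra.
  - by rewrite cE dE; lra.
  - by move=> x xa; rewrite homeoI_mulE !f_fix0.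
  - by move=> x; rewrite cE => xc; rewrite homeoI_mulE !(root_f_fix rt).
  - move=> x; rewrite aE cE homeoI_mulE => /(root_f_lt rt).
    exact: le_lt_trans (f_le _).
  - by move=> x; rewrite bE => xb; rewrite homeoI_mulE !(root_g_fix rt).
  - by move=> x xd; rewrite homeoI_mulE !g_fix1.
  - move=> x; rewrite bE dE homeoI_mulE => /(root_g_lt rt).
    exact: le_lt_trans (g_le _).
  (* With [g^2 (2/3) = 13/27], one application of [f] gives at most [7/18 <= 4/9], and a second one
     then gives at most [f (4/9) = 1/3]. *)
  - rewrite !homeoI_mulE bE -(root_f_third rt eE) homeoI_leE.
    have := root_f_le rt (x := g (g c)); rewrite ggc eE => le_f.
    by apply: le_trans (le_f _) _; lra.
split.
- by exists a, c; split=> //; rewrite aE cE; lra.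
- by exists b, d; split=> //; rewrite bE dE; lra.
- by exists b, c; split=> //; rewrite bE cE; lra.
- split; first exact: subIsetl.
  rewrite sfg sf => /(_ b) /=; rewrite ltxx aE bE cE => abs.
  by suff : false by []; apply: abs; lra.
- split; first exact: subIsetr.
  rewrite sfg sg => /(_ c) /=; rewrite ltxx bE cE dE andbF => abs.
  by suff : false by []; apply: abs; lra.
Qed.

End Roots.

(** * Uncountably many root pairs against countably many presentation codes *)

Theorem corollary1p10 (R : realType) :
  exists G : groupClosed (homeoI R),
    square_root_F G /\ ~ finitely_presented (subgroup G).
Proof.
apply: contrapT => allfp.
pose I := (`](1 / 3)%R, (5 / 12)%R[%classic : set R).
have codeP (t : R) : exists c, I t -> exists f g : homeoI R, root_pair t f g /\
    [set w | eval (marking f g) w = 1] = coded_kernel c.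
  have [It|nIt] := pselect (I t); last first.
    (* An arbitrary code outside [I], so that [choice] yields a function on all of [R]. *)
    by exists (existT _ 0%N ([::], ([::], [::]))).
  have [f [g rt]] : exists f g : homeoI R, root_pair t f g.
    by apply: root_pair_exists; move: It; rewrite /I /= in_itv.
  have [c cP] : exists c, [set w | eval (marking f g) w = 1] = coded_kernel c.
    apply: finitely_presented_code; apply: contrapT => nfp; apply: allfp.
    exists (generated [set f; g] : groupClosed _).
    by split=> //; exact: root_pair_square_root rt.
  by exists c => _; exists f, g.
have [code codeE] := choice codeP.
have code_lt (t t' : R) : I t -> I t' -> (t < t')%R -> code t <> code t'.
  move=> It It' tt' E.
  have [f [g [rt fgE]]] := codeE t It.
  have [f' [g' [rt' fgE']]] := codeE t' It'.
  move: It It'; rewrite /I /= !in_itv /= => /andP[t1 _] /andP[_ t2].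
  by apply: (root_pair_kernel_neq t1 tt' t2 rt rt'); rewrite fgE fgE' E.
have : countable I.
  apply/countable_injP.
  exists (fun t => pickle (code t :
    {n : nat & (seq (word n) * (word n * word n))%type})).
  move=> t t' /set_mem It /set_mem It' /(pcan_inj pickleK) E.
  case: (ltgtP t t') => // [/(code_lt _ _ It It')|/(code_lt _ _ It' It)] //.
  by move=> /(_ (esym E)).
(* A countable set is null, whereas [I] has measure [5/12 - 1/3 = 1/12]. *)
move/countable_lebesgue_measure0; rewrite lebesgue_measure_itv /= lte_fin.
case: ifP => [_|]; last by move/negP; case; lra.
by rewrite -EFinB => -[]; lra.
Qed.
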